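(* Let $\mathcal F_t$ be a $\sigma$-algebra, let $\theta_t$ be an $\mathcal F_t$-measurable random vector in $\mathbb R^d$, and let $Z_{t+1}$ be a random draw whose conditional distribution given $\mathcal F_t$ is $P_0$. Let $\widetilde G_t=\widetilde G(\theta_t,Z_{t+1})$ be the unclipped detached gradient, $G_t=G(\theta_t,Z_{t+1})=\operatorname{Clip}_{1.0}(\widetilde G_t)$ the clipped one, and $h(\theta)=\mathbb E_{Z\sim P_0}[G(\theta,Z)]$. Suppose that $$\widetilde G_t=R\,D(W_t)\,\mathbf u_t,$$ where $\mathbf u_t$ is a random vector in $\mathbb R^n$ (the local coordinate gradients), $W_t$ is a random vector in $\mathbb R^n$ (the weight array $\mathcal W_{\mathrm{ref}}(Z_{t+1})$ indexed by the local coordinates), $D(W_t)$ is the $n\times n$ diagonal matrix with diagonal $W_t$, and $R:\mathbb R^n\to\mathbb R^d$ is a fixed linear map. Then, almost surely, $$\operatorname{Var}(G_t\mid\mathcal F_t)\le\|R\|_{\mathrm{op}}^2\,\mathbb E\bigl[\|W_t\|_\infty^2\,\|\mathbf u_t\|_2^2\,\big|\,\mathcal F_t\bigr]-\|h(\theta_t)\|_2^2 .$$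
   Context: $\operatorname{Var}(G_t\mid\mathcal F_t)=\mathbb E\bigl[\|G_t-\mathbb E[G_t\mid\mathcal F_t]\|_2^2\mid\mathcal F_t\bigr]$ for vector-valued $G_t$. $\|\cdot\|_{\mathrm{op}}$ is the operator norm with respect to Euclidean norms. The conditional expectation on the right is of a nonnegative random variable and may be $+\infty$. A draw $Z$ (in a measurable space with distribution $P_0$) consists of a preference minibatch together with all diffusion randomness used in one gradient calculation. Given are a loss $\ell(\theta,z;w)$, differentiable in $\theta\in\mathbb R^d$, and a map $\mathcal W_{\mathrm{ref}}$ assigning to each draw $z$ a weight array. The detached gradient is $\widetilde G(\theta,z)=\nabla_\theta\,\ell(\theta,z;w)\big|_{w=\mathcal W_{\mathrm{ref}}(z)}$ (the weight array is treated as constant in differentiation), and $G(\theta,z)=\operatorname{Clip}_{1.0}(\widetilde G(\theta,z))$, where $\operatorname{Clip}_{1.0}(g)=g$ if $\|g\|_2\le1$ and $g/\|g\|_2$ otherwise. All these maps are assumed (jointly) measurable. *)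

(* Defs.v *)
From HB Require Import structures.
From mathcomp Require Import all_boot all_order all_algebra.
From mathcomp Require Import all_classical all_reals all_analysis.
From mathcomp Require Import measurable_realfun.
Set Implicit Arguments.
Unset Strict Implicit.
Unset Printing Implicit Defensive.
Import Order.TTheory GRing.Theory Num.Theory.
Import numFieldNormedType.Exports.
Local Open Scope classical_set_scope.
Local Open Scope ring_scope.

(* Vectors are rows throughout, and R^n carries its Borel sigma-algebra. *)
HB.instance Definition _ (R : realType) (n : nat) :=
  @isMeasurable.Build (sigma_display (@open 'rV[R]_n)) 'rV[R]_n
    <<s @open 'rV[R]_n >>
    (@sigma_algebra0 _ setT open) (@sigma_algebraC _ open)
    (@sigma_algebra_bigcup _ setT open).

Section Vectors.
Context {R : realType}.

(* The library norm `|v| on 'rV[R]_n is the sup norm; this is the Euclidean one. *)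
Definition norm2 {n : nat} (v : 'rV[R]_n) : R :=
  Num.sqrt (\sum_(i < n) v 0 i ^+ 2).

Definition opnorm {n d : nat} (L : 'rV[R]_n -> 'rV[R]_d) : R :=
  sup [set norm2 (L v) | v in [set v | norm2 v <= 1]].

Definition clip1 {d : nat} (g : 'rV[R]_d) : 'rV[R]_d :=
  if norm2 g <= 1 then g else (norm2 g)^-1 *: g.

Definition gradient {d : nat} (f : 'rV[R]_d -> R) (x : 'rV[R]_d) : 'rV[R]_d :=
  \row_(i < d) 'D_(delta_mx 0 i) f x.

(* The weights are evaluated at the draw and held fixed: only the first
   argument of [loss] is differentiated. *)
Definition detached_gradient {d n : nat} {Z : Type}
    (loss : 'rV[R]_d -> Z -> 'rV[R]_n -> R) (Wref : Z -> 'rV[R]_n)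
    (theta : 'rV[R]_d) (z : Z) : 'rV[R]_d :=
  gradient (fun theta' => loss theta' z (Wref z)) theta.

Definition clipped_gradient {d n : nat} {Z : Type}
    (loss : 'rV[R]_d -> Z -> 'rV[R]_n -> R) (Wref : Z -> 'rV[R]_n)
    (theta : 'rV[R]_d) (z : Z) : 'rV[R]_d :=
  clip1 (detached_gradient loss Wref theta z).

Definition expectation_rV {d : nat} {dz : measure_display}
    {Z : measurableType dz} (P : probability Z R) (X : Z -> 'rV[R]_d) :
    'rV[R]_d :=
  \row_(i < d) Rintegral P setT (fun z => X z 0 i).

End Vectors.

Section ConditionalExpectation.
Context {d0 : measure_display} {T : measurableType d0} {R : realType}.
Variable P : probability T R.

Definition sub_sigma_algebra_of (F : set (set T)) : Prop :=
  sigma_algebra setT F /\ F `<=` measurable.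

(* When F is a sigma-algebra, the measurable sets of [g_sigma_algebraType F]
   are exactly those of F. *)
Definition measurable_wrt {d1 : measure_display} {U : measurableType d1}
    (F : set (set T)) (f : T -> U) : Prop :=
  measurable_fun [set: g_sigma_algebraType F] (f : g_sigma_algebraType F -> U).

(* Conditional expectations are handled through their versions: the predicates
   below say that Y is a version of E[X | F]. *)
Definition is_condexp (F : set (set T)) (X Y : T -> R) : Prop :=
  [/\ P.-integrable setT (EFin \o X),
      measurable_wrt F Y,
      P.-integrable setT (EFin \o Y) &
      forall A, F A ->
        (\int[P]_(x in A) (Y x)%:E = \int[P]_(x in A) (X x)%:E)%E].

(* X is nonnegative but not assumed integrable, so Y is [0, +oo]-valued. *)
Definition is_condexp_ge0 (F : set (set T)) (X Y : T -> \bar R) : Prop :=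
  [/\ measurable_fun setT X /\ (forall x, (0 <= X x)%E),
      measurable_wrt F Y,
      (forall x, (0 <= Y x)%E) &
      forall A, F A -> (\int[P]_(x in A) Y x = \int[P]_(x in A) X x)%E].

Definition is_condexp_rV {d : nat} (F : set (set T)) (X Y : T -> 'rV[R]_d) :
    Prop :=
  forall i : 'I_d, is_condexp F (fun x => X x 0 i) (fun x => Y x 0 i).

(* V is a version of Var(G | F) = E[ ||G - E[G | F]||_2^2 | F ]. *)
Definition is_condvar {d : nat} (F : set (set T)) (G : T -> 'rV[R]_d)
    (V : T -> \bar R) : Prop :=
  exists2 M : T -> 'rV[R]_d, is_condexp_rV F G M &
    is_condexp_ge0 F (fun x => (norm2 (G x - M x) ^+ 2)%:E) V.

(* P0 is the conditional distribution of Z given F: P(Z \in B | F) = P0 B. *)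
Definition has_cond_distribution {dz : measure_display} {S : measurableType dz}
    (F : set (set T)) (Z : T -> S) (P0 : probability S R) : Prop :=
  forall B : set S, measurable B ->
    is_condexp F (\1_(Z @^-1` B)) (cst (fine (P0 B))).

End ConditionalExpectation.

(* Main.v *)
Require Import Defs.
From HB Require Import structures.
From mathcomp Require Import all_boot all_order all_algebra.
From mathcomp Require Import all_classical all_reals all_analysis.
From mathcomp Require Import measurable_realfun.
From mathcomp Require Import ring lra.
Import Order.TTheory GRing.Theory Num.Theory.
Import numFieldNormedType.Exports.
Local Open Scope classical_set_scope.
Local Open Scope ring_scope.

(* Since Z has conditional law P0 given F, the joint law of (omega, Z) on
   F (x) S is the product of P|_F and P0.  Fubini-Tonelli then gives
   E[G | F] = h(theta) a.s., and combined with
   E||X - EX||^2 + ||EX||^2 = E||X||^2 under P0, for each frozen theta, it gives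
   E[V + ||h(theta)||^2 ; A] = E[||G||^2 ; A] for every A in F.  Clipping does
   not increase the norm, so pointwise
   ||G||^2 <= ||L D(W) u||^2 <= ||L||_op^2 ||W||_oo^2 ||u||^2;
   comparing integrals over all A in F yields the a.s. inequality. *)

(** * Euclidean norm, clipping and the operator norm *)

Section EuclideanNorm.
Set Implicit Arguments.
Unset Strict Implicit.
Context {R : realType}.
Implicit Types n d : nat.

Lemma norm2_ge0 n (v : 'rV[R]_n) : 0 <= norm2 v.
Proof. exact: sqrtr_ge0. Qed.

Lemma sqr_norm2 n (v : 'rV[R]_n) : norm2 v ^+ 2 = \sum_(i < n) v 0 i ^+ 2.
Proof. by rewrite sqr_sqrtr// sumr_ge0// => i _; exact: sqr_ge0. Qed.

Lemma norm2Z n (a : R) (v : 'rV[R]_n) : norm2 (a *: v) = `|a| * norm2 v.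
Proof.
rewrite /norm2 -sqrtr_sqr -sqrtrM ?sqr_ge0// mulr_sumr.
by congr Num.sqrt; apply: eq_bigr => i _; rewrite mxE exprMn.
Qed.

Lemma norm_coord_le_norm2 n (v : 'rV[R]_n) i : `|v 0 i| <= norm2 v.
Proof.
rewrite -sqrtr_sqr ler_wsqrtr// (bigD1 i)//= lerDl sumr_ge0// => j _.
exact: sqr_ge0.
Qed.

Lemma norm2_eq0 n (v : 'rV[R]_n) : norm2 v = 0 -> v = 0.
Proof.
move=> v0; apply/rowP => i; rewrite mxE; apply/eqP.
by rewrite -normr_le0 -v0 norm_coord_le_norm2.
Qed.

Lemma norm2_clip1_le1 d (g : 'rV[R]_d) : norm2 (clip1 g) <= 1.
Proof.
rewrite /clip1; case: ifPn => // /negP/negP; rewrite -ltNge => g1.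
have g0 : 0 < norm2 g by rewrite (lt_trans _ g1).
by rewrite norm2Z ger0_norm ?invr_ge0 ?norm2_ge0// mulVf// gt_eqF.
Qed.

Lemma norm2_clip1_le d (g : 'rV[R]_d) : norm2 (clip1 g) <= norm2 g.
Proof.
have [g1|g1] := leP (norm2 g) 1; first by rewrite /clip1 g1.
exact: le_trans (norm2_clip1_le1 g) (ltW g1).
Qed.

(** Homogeneity reduces the bound to the unit ball, but [sup] dominates the image of the ball only
    once that image is known to be bounded. *)
Lemma norm2_le_opnorm n d (L : {linear 'rV[R]_n -> 'rV[R]_d}) (v : 'rV[R]_n) :
  norm2 (L v) <= opnorm L * norm2 v.
Proof.
have ball_bound : has_ubound [set norm2 (L w) | w in [set w | norm2 w <= 1]].
  (* Coordinates of [w] in the unit ball have absolute value at most 1, so [b j], a sum of absolute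
     matrix entries of [L], bounds coordinate [j] of [L w]. *)
  pose b j := \sum_(i < n) `|L (delta_mx 0 i) 0 j|.
  exists (Num.sqrt (\sum_(j < d) b j ^+ 2)) => _ [w /= w1 <-].
  rewrite ler_wsqrtr// ler_sum// => j _; rewrite -real_normK ?num_real//.
  rewrite lerXn2r ?nnegrE ?sumr_ge0// {1}(row_sum_delta w) linear_sum summxE.
  rewrite (le_trans (ler_norm_sum _ _ _))// ler_sum// => i _.
  rewrite linearZ mxE normrM ler_piMl//.
  exact: le_trans (norm_coord_le_norm2 _ _) w1.
have [v0|v0] := eqVneq (norm2 v) 0.
  by rewrite v0 mulr0 (norm2_eq0 v0) linear0 -(scale0r 0) norm2Z normr0 mul0r.
have vp : 0 < norm2 v by rewrite lt_def v0 norm2_ge0.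
rewrite -ler_pdivrMr// mulrC -[X in X * _]ger0_norm ?invr_ge0 ?norm2_ge0//.
rewrite -norm2Z -linearZ; apply: ub_le_sup => //.
exists ((norm2 v)^-1 *: v) => //=.
by rewrite norm2Z ger0_norm ?invr_ge0 ?norm2_ge0// mulVf.
Qed.

(** By convention [sup] is 0 on a set without supremum; otherwise it dominates [norm2 (L 0)], since
    0 lies in the unit ball. *)
Lemma opnorm_ge0 n d (L : 'rV[R]_n -> 'rV[R]_d) : 0 <= opnorm L.
Proof.
rewrite /opnorm; set E := [set _ | _ in _].
have [supE|/sup_out->//] := pselect (has_sup E).
apply: le_trans (norm2_ge0 (L 0)) _; apply: sup_upper_bound => //.
by exists 0 => //=; rewrite -(scale0r 0) norm2Z normr0 mul0r.
Qed.

(** Here [|w|] is the sup norm, which bounds the factor multiplying each coordinate of [u]. *)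
Lemma norm2_mul_diag_le n (u w : 'rV[R]_n) :
  norm2 (u *m diag_mx w) <= `|w| * norm2 u.
Proof.
rewrite -[X in X * _]ger0_norm// -norm2Z ler_wsqrtr// ler_sum// => i _.
rewrite mul_mx_diag !mxE !exprMn mulrC ler_wpM2r ?sqr_ge0//.
rewrite -real_normK ?num_real// lerXn2r ?nnegrE//.
rewrite [leRHS]/Num.norm/= mx_normrE.
exact: (le_bigmax _ (fun ij : 'I_1 * 'I_n => `|w ij.1 ij.2|) (0, i)).
Qed.

End EuclideanNorm.

(** * Measurability, almost-everywhere comparison and second moments *)

Section ConditionalVariance.
Set Implicit Arguments.
Unset Strict Implicit.
Variable R : realType.

Lemma measurable_coord n (i : 'I_n) :
  measurable_fun setT (fun v : 'rV[R]_n => v 0 i).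
Proof.
apply: (measurability _ (RGenOpens.measurableE R)) => _ [_ [a [b ->] <-]].
rewrite setTI; apply: sub_sigma_algebra.
have /continuousP := @coord_continuous R 1 n 0 i.
by apply; exact: interval_open.
Qed.

Lemma measurable_norm2X n d (T : measurableType d) (X : T -> 'rV[R]_n) :
  (forall i, measurable_fun setT (fun x => X x 0 i)) ->
  measurable_fun setT (fun x => norm2 (X x) ^+ 2).
Proof.
move=> mX; under eq_fun do rewrite sqr_norm2.
by apply: measurable_sum => i; exact: measurable_funX.
Qed.

Local Open Scope ereal_scope.

(** On the set where [g < f], the integral hypothesis and the pointwise inequality force equal
    integrals over every measurable subset, so [f = g] almost everywhere there and the set is null.
    The function [g] may take the value +oo, as the conditional expectation on the right of the
    theorem may. *)
Lemma integrable_le_ae d (T : measurableType d)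
    (mu : {measure set T -> \bar R}) (f g : T -> \bar R) :
  mu.-integrable setT f -> measurable_fun setT g -> (forall x, 0 <= g x) ->
  (forall A, measurable A ->
    \int[mu]_(x in A) f x <= \int[mu]_(x in A) g x) ->
  {ae mu, forall x, f x <= g x}.
Proof.
move=> intf mg g0 fg; pose B := [set x | g x < f x].
have mf := measurable_int _ intf.
have mB : measurable B by rewrite -[B]setTI; exact: measurable_lte.
have : ae_eq mu B f g.
  apply: integral_ae_eq => //.
  - by apply: integrableS intf.
  - exact: measurable_funTS.
  move=> E EB mE; apply/eqP; rewrite eq_le fg//=.
  apply: ge0_le_integral => //.
  - exact: measurable_funTS.
  - exact: measurable_funTS.
  - by move=> x /EB /ltW.
apply: filterS => x fgx; rewrite leNgt; apply/negP => Bx.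
by move: (Bx); rewrite fgx// ltxx.
Qed.

(** Carries statements proved under the law of [X] back to the sample space: preimages of null sets
    are null. *)
Lemma ae_distribution d d' (T : measurableType d) (T' : measurableType d')
    (P : probability T R) (X : {RV P >-> T'}) (Q : T' -> Prop) :
  {ae distribution P X, forall y, Q y} -> {ae P, forall x, Q (X x)}.
Proof.
case=> N [mN N0 QN]; exists (X @^-1` N); split => //.
  by rewrite -[_ @^-1` _]setTI; exact: measurable_funPT.
by move=> x; exact: QN.
Qed.

Lemma bounded_integrable d (T : measurableType d) (P : probability T R)
    (X : T -> R) (c : R) :
  measurable_fun setT X -> (forall x, `|X x| <= c)%R ->
  P.-integrable setT (EFin \o X).
Proof.
move=> mX Xc; apply: measurable_bounded_integrable => //.
  by rewrite ltey_eq fin_num_measure.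
exists c; split; first exact: num_real.
by move=> M cM x _; exact: le_trans (Xc x) (ltW cM).
Qed.

(** Expand the square and integrate term by term; boundedness of [X] makes every term integrable. *)
Lemma second_moment_decomposition d (T : measurableType d)
    (P : probability T R) (X : T -> R) (c : R) :
  measurable_fun setT X -> (forall x, `|X x| <= c)%R ->
  let m := Rintegral P setT X in
  \int[P]_x ((X x - m) ^+ 2)%:E + (m ^+ 2)%:E = \int[P]_x (X x ^+ 2)%:E.
Proof.
move=> mX Xc m.
have iX := bounded_integrable P mX Xc.
have iX2 : P.-integrable setT (EFin \o (fun x => X x ^+ 2)%R).
  apply: (@bounded_integrable _ _ _ _ (c ^+ 2)%R); first exact: measurable_funX.
  by move=> x; rewrite normrX lerXn2r ?nnegrE// (le_trans _ (Xc x)).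
have imX : P.-integrable setT (EFin \o (fun x => (- (m *+ 2)) * X x)%R).
  exact: (integrableZl measurableT (- (m *+ 2))%R iX).
have ic : P.-integrable setT (cst (m ^+ 2)%:E).
  by apply: (@bounded_integrable _ _ _ (cst (m ^+ 2)%R) `|m ^+ 2|%R).
have mE : \int[P]_x (X x)%:E = m%:E.
  by rewrite fineK// integrable_fin_num.
have mXE : \int[P]_x (- (m *+ 2) * X x)%:E = (- (m *+ 2))%:E * m%:E.
  by rewrite -mE -integralZl.
have cE : \int[P]_x (m ^+ 2)%:E = (m ^+ 2)%:E.
  by rewrite integral_cst// [X in _ * X](probability_setT P) mule1.
under eq_integral => x _.
  rewrite (_ : (_ ^+ 2)%R = (X x ^+ 2 + - (m *+ 2) * X x + m ^+ 2)%R);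
    last by ring.
  rewrite EFinD EFinD.
  over.
rewrite integralD//; last exact: integrableD.
rewrite integralD// mXE cE.
rewrite -!addeA -EFinM -!EFinD (_ : (- (m *+ 2) * m + _ = 0)%R) ?adde0//.
by ring.
Qed.

(** The scalar decomposition is summed over coordinates, each bounded by 1 because the norm is. *)
Lemma variance_decomposition n d (T : measurableType d)
    (P : probability T R) (X : T -> 'rV[R]_n) :
  (forall i, measurable_fun setT (fun x => X x 0%R i)) ->
  (forall x, norm2 (X x) <= 1)%R ->
  let m := expectation_rV P X in
  \int[P]_x (norm2 (X x - m)%R ^+ 2)%:E + (norm2 m ^+ 2)%:E =
  \int[P]_x (norm2 (X x) ^+ 2)%:E.
Proof.
move=> mX X1 m.
have sumE (Y : T -> 'rV[R]_n) :
    (forall i, measurable_fun setT (fun x => Y x 0%R i)) ->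
    \int[P]_x (norm2 (Y x) ^+ 2)%:E =
    \sum_(i < n) \int[P]_x (Y x 0%R i ^+ 2)%:E.
  move=> mY; rewrite -ge0_integral_sum//; last 2 first.
  - by move=> i; apply/measurable_EFinP; exact: measurable_funX.
  - by move=> i x _; rewrite lee_fin sqr_ge0.
  by apply: eq_integral => x _; rewrite sqr_norm2 sumEFin.
rewrite !sumE//; last first.
  move=> i; under eq_fun do rewrite !mxE.
  by apply: measurable_funB.
rewrite sqr_norm2 -sumEFin -big_split/=; apply: eq_bigr => i _.
rewrite -(@second_moment_decomposition _ _ P (fun x => X x 0%R i) 1%R)//;
    last first.
  by move=> x; apply: le_trans (norm_coord_le_norm2 (X x) i) (X1 x).
by congr (_ + _); [apply: eq_integral => x _|]; rewrite !mxE.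
Qed.

(* A sub-sigma-algebra is modelled by a measurable map p into T1; in the
   theorem, p is the identity of Omega and T1 is Omega equipped with F. *)
Section Disintegration.
Context d d1 d2 (T : measurableType d) (T1 : measurableType d1)
  (S : measurableType d2) (P : probability T R) (P0 : probability S R).
Context (p : {RV P >-> T1}) (Z : {RV P >-> S}).
Hypothesis pZ_product : forall (A : set T1) (B : set S),
  measurable A -> measurable B ->
  P (p @^-1` A `&` Z @^-1` B) = P (p @^-1` A) * P0 B.

(** The product formula on rectangles identifies the joint law of [p] and [Z] with the product of
    the law of [p] and [P0], by uniqueness of product measures; Tonelli then splits the integral. *)
Lemma integral_disintegration (A : set T1) (k : T1 * S -> \bar R) :
  measurable A -> measurable_fun setT k -> (forall y, 0 <= k y) ->
  \int[P]_(x in p @^-1` A) k (p x, Z x) =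
  \int[distribution P p]_(x in A) \int[P0]_z k (x, z).
Proof.
move=> mA mk k0.
have mpZ : measurable_fun setT (fun x => (p x, Z x)).
  exact: measurable_fun_pair.
(* Extension by zero turns the integral over [A] into one over the whole product space. *)
pose kA := k \_ (A `*` setT).
have kA0 y : 0 <= kA y by apply: erestrict_ge0.
have mAT : measurable (A `*` [set: S]) by exact: measurableX.
have mkA : measurable_fun setT kA.
  by apply/measurable_restrict => //; rewrite setTI; exact: measurable_funTS.
transitivity (\int[pushforward P (fun x => (p x, Z x))]_y kA y).
  rewrite ge0_integral_pushforward// preimage_setT.
  rewrite [LHS]integral_mkcond; apply: eq_integral => x _ /=.
  rewrite /kA !patchE; congr (if _ then _ else _).
  by apply/idP/idP; rewrite !inE => // -[].
pose mpZ_mixin := isMeasurableFun.Build _ _ _ _ _ mpZ.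
pose pZ : {RV P >-> (T1 * S)%type} := HB.pack (fun x => (p x, Z x)) mpZ_mixin.
rewrite -[pushforward _ _]/(distribution P pZ : set _ -> \bar R).
rewrite -(eq_measure_integral (distribution P pZ)
    (m1 := distribution P p \x P0)); last first.
  move=> E mE _; apply: product_measure_unique mE => B C mB mC.
  exact: pZ_product.
rewrite fubini_tonelli1// [RHS]integral_mkcond.
apply: eq_integral => x _; rewrite /fubini_F patchE.
case: ifPn => xA.
  by apply: eq_integral => z _; rewrite /kA patchE in_setX xA in_setT.
by apply: integral0_eq => z _; rewrite /kA patchE in_setX (negbTE xA).
Qed.

(** * Conditional mean and conditional variance of a bounded vector *)

Variables (n : nat) (g : T1 * S -> 'rV[R]_n).
Hypothesis mg : forall i, measurable_fun setT (fun y => g y 0%R i).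
Hypothesis g1 : forall y, (norm2 (g y) <= 1)%R.

Let h x := expectation_rV P0 (fun z => g (x, z)).

Let mgx x i : measurable_fun setT (fun z => g (x, z) 0%R i).
Proof. exact: measurableT_comp (mg i) (pair1_measurable x). Qed.

Let coord_g1 y i : (`|g y 0 i| <= 1)%R.
Proof. exact: le_trans (norm_coord_le_norm2 _ _) (g1 y). Qed.

(* The shift makes the coordinate nonnegative, so that Tonelli's theorem
   applies to it. *)
Let shifted_coord y i := (g y 0%R i + 1)%R%:E.

Let shifted_coord_ge0 i y : 0 <= shifted_coord y i.
Proof. by have := coord_g1 y i; rewrite lee_fin ler_norml; lra. Qed.

Let measurable_shifted_coord i : measurable_fun setT (shifted_coord ^~ i).
Proof. by apply/measurable_EFinP; exact: measurable_funD. Qed.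

Let integral_shifted_coord x i :
  \int[P0]_z shifted_coord (x, z) i = (h x 0%R i + 1)%:E.
Proof.
have ig : P0.-integrable setT (EFin \o (fun z => g (x, z) 0%R i)).
  exact: (@bounded_integrable _ _ _ _ 1%R).
have i1 : P0.-integrable setT (cst 1%:E).
  by apply: (@bounded_integrable _ _ _ (cst 1%R) 1%R) => // z; rewrite normr1.
rewrite /shifted_coord; under eq_integral do rewrite EFinD.
rewrite integralD// integral_cst// [X in _ + _ * X](probability_setT P0) mule1.
by rewrite mxE EFinD fineK// integrable_fin_num.
Qed.

(** Tonelli gives measurability of the integrated shifted coordinate; subtracting the shift recovers
    [h]. *)
Let measurable_mean i : measurable_fun setT (fun x => h x 0%R i).
Proof.
apply/measurable_EFinP.
have -> : EFin \o (fun x => h x 0%R i) =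
    (fun x => \int[P0]_z shifted_coord (x, z) i - 1).
  by apply/funext => x; rewrite integral_shifted_coord/= -EFinB addrK.
apply: emeasurable_funB => //.
exact: (measurable_fun_fubini_tonelli_F (m2 := P0) (shifted_coord ^~ i)).
Qed.

(** By disintegration, [M + 1] and [h + 1] have equal integrals over every measurable set under the
    law of [p], hence agree almost everywhere; the shift then cancels. *)
Lemma condexp_eq_mean i (M : T1 -> R) :
  measurable_fun setT M -> P.-integrable setT (EFin \o M \o p) ->
  (forall A, measurable A -> \int[P]_(x in p @^-1` A) (M (p x))%:E =
    \int[P]_(x in p @^-1` A) (g (p x, Z x) 0%R i)%:E) ->
  {ae P, forall x, M (p x) = h (p x) 0%R i}.
Proof.
move=> mM iM MG.
have mp A : measurable A -> measurable (p @^-1` A).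
  by move=> mA; rewrite -[_ @^-1` _]setTI; exact: measurable_funPT.
have i1 : P.-integrable setT (cst 1%:E).
  by apply: (@bounded_integrable _ _ _ (cst 1%R) 1%R) => // z; rewrite normr1.
have iM1 : P.-integrable setT ((fun y => (M y + 1)%R%:E) \o p).
  exact: (integrableD measurableT iM i1).
have mM1 : measurable_fun setT (fun y => (M y + 1)%R%:E).
  by apply/measurable_EFinP; exact: measurable_funD.
have mG : measurable_fun setT (fun x => g (p x, Z x) 0%R i).
  by apply: measurableT_comp (mg i) _; exact: measurable_fun_pair.
have iG : P.-integrable setT (EFin \o (fun x => g (p x, Z x) 0%R i)).
  exact: (@bounded_integrable _ _ _ _ 1%R).
suff : ae_eq (distribution P p) setT (fun y => (M y + 1)%R%:E)
    (fun y => \int[P0]_z shifted_coord (y, z) i).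
  move=> /(@ae_distribution _ _ _ _ P p (fun y => setT y -> _)).
  apply: filterS => x /(_ I); rewrite integral_shifted_coord => -[].
  exact: addIr.
apply: integral_ae_eq => //.
- by apply: integrable_pushforward; rewrite ?preimage_setT.
- exact: (measurable_fun_fubini_tonelli_F (m2 := P0) (shifted_coord ^~ i)).
move=> A _ mA.
rewrite -(integral_disintegration (k := shifted_coord ^~ i))//.
have iA f : P.-integrable setT f -> P.-integrable (p @^-1` A) f.
  by move=> fi; apply: integrableS fi => //; exact: mp.
rewrite integral_pushforward//; last exact: iA.
transitivity (\int[P]_(x in p @^-1` A) ((M (p x))%:E + 1)) => //.
rewrite integralD//; [|exact: mp|exact: iA|exact: iA].
rewrite MG// -integralD//; [exact: mp|exact: iA|exact: iA].
Qed.

(** In the application [B] is the squared weight norm times the squared local gradient norm, [C] a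
    version of its conditional expectation, and [c] the squared operator norm. *)
Lemma condvar_le (M : T1 -> 'rV[R]_n) (V C : T1 -> \bar R) (B : T -> \bar R)
    (c : R) :
  (forall i, measurable_fun setT (fun y => M y 0%R i)) ->
  (forall i, P.-integrable setT (EFin \o (fun y => M y 0%R i) \o p)) ->
  (forall i A, measurable A -> \int[P]_(x in p @^-1` A) (M (p x) 0%R i)%:E =
    \int[P]_(x in p @^-1` A) (g (p x, Z x) 0%R i)%:E) ->
  measurable_fun setT V -> (forall y, 0 <= V y) ->
  measurable_fun setT C -> (forall y, 0 <= C y) ->
  measurable_fun setT B -> (forall x, 0 <= B x) -> (0 <= c)%R ->
  (forall A, measurable A -> \int[P]_(x in p @^-1` A) V (p x) =
    \int[P]_(x in p @^-1` A) (norm2 (g (p x, Z x) - M (p x))%R ^+ 2)%:E) ->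
  (forall A, measurable A -> \int[P]_(x in p @^-1` A) C (p x) =
    \int[P]_(x in p @^-1` A) B x) ->
  {ae P, forall x, (norm2 (g (p x, Z x)) ^+ 2)%:E <= c%:E * B x} ->
  {ae P, forall x, V (p x) <= c%:E * C (p x) - (norm2 (h (p x)) ^+ 2)%:E}.
Proof.
move=> mM iM MG mV V0 mC C0 mB B0 c0 VE CE GB.
have mp A : measurable A -> measurable (p @^-1` A).
  by move=> mA; rewrite -[_ @^-1` _]setTI; exact: measurable_funPT.
have mpZ : measurable_fun setT (fun x => (p x, Z x)).
  exact: measurable_fun_pair.
have sqr_norm2_ge0 m (v : 'rV[R]_m) : 0 <= (norm2 v ^+ 2)%:E.
  by rewrite lee_fin sqr_ge0.
have mh2 : measurable_fun setT (fun y => (norm2 (h y) ^+ 2)%:E).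
  by apply/measurable_EFinP; exact: measurable_norm2X.
have mg2 : measurable_fun setT (fun y => (norm2 (g y) ^+ 2)%:E).
  by apply/measurable_EFinP; exact: measurable_norm2X.
have mG2 : measurable_fun setT (fun x => (norm2 (g (p x, Z x)) ^+ 2)%:E).
  exact: (measurableT_comp mg2 mpZ).
have mgk2 (k : T1 -> 'rV[R]_n) :
    (forall i, measurable_fun setT (fun y => k y 0%R i)) ->
    measurable_fun setT (fun y => (norm2 (g y - k y.1)%R ^+ 2)%:E).
  move=> mk; apply/measurable_EFinP; apply: measurable_norm2X => i.
  rewrite (_ : (fun y => _) = (fun y => g y 0%R i - k y.1 0%R i)%R); last first.
    by apply/funext => y; rewrite !mxE.
  apply: measurable_funB => //.
  exact: (measurableT_comp (mk i) measurable_fst).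
have mgh2 := mgk2 h measurable_mean.
(* There are finitely many coordinates, so their exceptional null sets combine into one. *)
have Mh : {ae P, forall x, M (p x) = h (p x)}.
  have Mhi i : {ae P, forall x, M (p x) 0%R i = h (p x) 0%R i}.
    exact: (condexp_eq_mean (mM i) (iM i) (MG i)).
  have : {ae P, forall x, forall i, M (p x) 0%R i = h (p x) 0%R i}.
    exact: filter_forall.
  by apply: filterS => x Mhx; apply/rowP.
(* The variance decomposition needs centering at the exact mean [h], whereas [V] is centered at the
   version [M]. *)
have VhE A : measurable A -> \int[P]_(x in p @^-1` A) V (p x) =
    \int[P]_(x in p @^-1` A) (norm2 (g (p x, Z x) - h (p x))%R ^+ 2)%:E.
  move=> mA; rewrite VE//; apply: ge0_ae_eq_integral => //.
  - exact: mp.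
  - apply: measurable_funTS; exact: (measurableT_comp (mgk2 M mM) mpZ).
  - apply: measurable_funTS; exact: (measurableT_comp mgh2 mpZ).
  by apply: filterS Mh => x -> _.
(* E[V + ||h||^2 ; A] = E[||g||^2 ; A]: disintegrate, then apply the variance
   decomposition under P0 for each fixed first argument. *)
have sumE A : measurable A ->
    \int[distribution P p]_(y in A) (V y + (norm2 (h y) ^+ 2)%:E) =
    \int[P]_(x in p @^-1` A) (norm2 (g (p x, Z x)) ^+ 2)%:E.
  move=> mA.
  rewrite (integral_disintegration (k := fun y => (norm2 (g y) ^+ 2)%:E))//.
  rewrite ge0_integralD//; try exact: measurable_funTS.
  rewrite ge0_integral_pushforward//; last exact: measurable_funTS.
  rewrite VhE//.
  rewrite (integral_disintegration
    (k := fun y => (norm2 (g y - h y.1)%R ^+ 2)%:E))//.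
  rewrite -ge0_integralD//; try exact: measurable_funTS; last 2 first.
  - by move=> y _; exact: integral_ge0.
  - apply: measurable_funTS.
    exact: (measurable_fun_fubini_tonelli_F (m2 := P0) _ mgh2).
  by apply: eq_integral => y _; rewrite variance_decomposition.
have : {ae distribution P p,
    forall y, V y + (norm2 (h y) ^+ 2)%:E <= c%:E * C y}.
  apply: integrable_le_ae.
  (* The total integral of the left side is the second moment of [g], at most 1 since the norm of
     [g] is. *)
  - apply/integrableP; split; first exact: emeasurable_funD.
    under eq_integral do rewrite gee0_abs ?adde_ge0//.
    rewrite sumE// preimage_setT (@le_lt_trans _ _ (\int[P]_x cst 1 x))//.
      apply: ge0_le_integral => // x _.
      by rewrite lee_fin expr_le1// norm2_ge0.
    by rewrite integral_cst// mul1e [X in X < _](probability_setT P) ltry.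
  - exact: measurable_funeM.
  - by move=> y; rewrite mule_ge0// lee_fin.
  move=> A mA; rewrite sumE//.
  (* The constant is taken out to pass from [C] to [B], then put back so that the pointwise bound
     applies. *)
  rewrite ge0_integralZl_EFin//; last exact: measurable_funTS.
  rewrite ge0_integral_pushforward//; last exact: measurable_funTS.
  rewrite CE// -ge0_integralZl_EFin//; [|exact: mp|exact: measurable_funTS].
  apply: ae_ge0_le_integral => //.
  - exact: mp.
  - exact: measurable_funTS.
  - by move=> x _; rewrite mule_ge0// lee_fin.
  - by apply: measurable_funTS; exact: measurable_funeM.
  by apply: filterS GB.
move=> /(@ae_distribution _ _ _ _ P p).
(* The squared norm of [h] is finite, so it can be moved across the inequality even where [C] is
   +oo. *)
by apply: filterS => x; rewrite leeBrDr.
Qed.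

End Disintegration.
End ConditionalVariance.

(** * Conditional variance of the clipped detached gradient *)

Theorem proposition2 (R : realType) (d n : nat)
  (dO dZ : measure_display) (Omega : measurableType dO) (S : measurableType dZ)
  (P : probability Omega R) (P0 : probability S R)
  (loss : 'rV[R]_d -> S -> 'rV[R]_n -> R) (Wref : S -> 'rV[R]_n)
  (loss_diff : forall (theta : 'rV[R]_d) (z : S) (w : 'rV[R]_n),
     differentiable (fun theta' => loss theta' z w) theta)
  (loss_meas : measurable_fun setT
     (fun x : 'rV[R]_d * S * 'rV[R]_n => loss x.1.1 x.1.2 x.2))
  (Wref_meas : measurable_fun setT Wref)
  (detached_meas : measurable_fun setT
     (fun x : 'rV[R]_d * S => detached_gradient loss Wref x.1 x.2))
  (clipped_meas : measurable_fun setT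
     (fun x : 'rV[R]_d * S => clipped_gradient loss Wref x.1 x.2))
  (F : set (set Omega)) (F_sigma : sub_sigma_algebra_of F)
  (theta : Omega -> 'rV[R]_d) (theta_meas : measurable_wrt F theta)
  (Z : Omega -> S) (Z_meas : measurable_fun setT Z)
  (Z_cond : has_cond_distribution P F Z P0)
  (W u : Omega -> 'rV[R]_n) (W_def : forall x, W x = Wref (Z x))
  (u_meas : measurable_fun setT u)
  (L : {linear 'rV[R]_n -> 'rV[R]_d})
  (factorization : {ae P, forall x,
     detached_gradient loss Wref (theta x) (Z x) = L (u x *m diag_mx (W x))})
  (V C : Omega -> \bar R)
  (V_condvar :
     is_condvar P F (fun x => clipped_gradient loss Wref (theta x) (Z x)) V)
  (C_condexp :
     is_condexp_ge0 P F (fun x => (`|W x| ^+ 2 * norm2 (u x) ^+ 2)%:E) C) :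
  {ae P, forall x,
     (V x <= (opnorm L ^+ 2)%:E * C x
             - (norm2 (expectation_rV P0
                         (clipped_gradient loss Wref (theta x))) ^+ 2)%:E)%E}.
Proof.
have [sF FT] := F_sigma; have [M HM [[mVr _] mV V0 VE]] := V_condvar.
have [[mB B0] mC C0 CE] := C_condexp.
pose T1 := g_sigma_algebraType F.
(* Since [F] is a sigma-algebra, generating one from it adds no sets. *)
have measurableE (A : set T1) : measurable A = F A.
  by rewrite /measurable/= sigma_algebra_id.
have mid : measurable_fun setT (id : Omega -> T1).
  by move=> _ A mA; rewrite setTI; apply: FT; rewrite -measurableE.
pose id_mixin := isMeasurableFun.Build _ _ _ _ _ mid.
pose p : {RV P >-> T1} := HB.pack (id : Omega -> T1) id_mixin.
pose Z_mixin := isMeasurableFun.Build _ _ _ _ _ Z_meas.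
pose ZRV : {RV P >-> S} := HB.pack Z Z_mixin.
pose g (y : T1 * S) := clipped_gradient loss Wref (theta y.1) y.2.
(* Measurability is with respect to [F] in the first factor; this is where [F]-measurability of
   [theta] enters. *)
have mg i : measurable_fun setT (fun y => g y 0 i).
  apply: (measurableT_comp (measurable_coord i)).
  have mtheta : measurable_fun setT (fun y : T1 * S => (theta y.1, y.2)).
    apply: measurable_fun_pair => //.
    exact: (measurableT_comp theta_meas measurable_fst).
  exact: (measurableT_comp clipped_meas mtheta).
have g1 y : norm2 (g y) <= 1 by exact: norm2_clip1_le1.
(* Integrating over [A] the constant version [P0 B] of the conditional probability that [Z] lies in
   [B] gives the product formula. *)
have product A B : measurable A -> measurable B ->
    (P (p @^-1` A `&` ZRV @^-1` B) = P (p @^-1` A) * P0 B)%E.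
  move=> mA mB'; have FA : F A by rewrite -measurableE.
  have [_ _ _ /(_ A FA)] := Z_cond B mB'.
  have mA' := FT _ FA.
  under eq_integral do rewrite /cst/=.
  rewrite integral_cst// integral_indic//.
    by rewrite fineK ?fin_num_measure// muleC setIC => <-.
  by rewrite -[_ @^-1` _]setTI; exact: (measurable_funPT ZRV).
apply: (condvar_le product mg g1 (M := M)
  (B := fun x => (`|W x| ^+ 2 * norm2 (u x) ^+ 2)%:E)) => //.
- by move=> i; have [] := HM i.
- by move=> i; have [] := HM i.
- by move=> i A; rewrite measurableE => FA; have [_ _ _ ->] := HM i.
- by rewrite sqr_ge0.
- by move=> A; rewrite measurableE; exact: VE.
- by move=> A; rewrite measurableE; exact: CE.
apply: filterS factorization => x Lx; rewrite -EFinM lee_fin.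
(* Both sides are squares of nonnegative numbers, so it suffices to chain the norm bounds for
   clipping, for [L] and for the diagonal factor. *)
rewrite -!exprMn lerXn2r ?nnegrE ?mulr_ge0 ?norm2_ge0//.
  exact: opnorm_ge0.
rewrite (le_trans (norm2_clip1_le _))// Lx (le_trans (norm2_le_opnorm _ _))//.
by rewrite ler_wpM2l ?norm2_mul_diag_le// opnorm_ge0.
Qed.
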